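(* The modified (super)characters $\widetilde{\rm ch}^{(\pm)}_{H(\Lambda^{[-1,0]})}$ are expressed through the honest (super)characters as $$\widetilde{\rm ch}^{(\pm)}_{H(\Lambda^{[-1,0]})}(\tau,z)=\frac12\big\{{\rm ch}^{(\pm)}_{H(\Lambda^{[-1,0]})}(\tau,z)+{\rm ch}^{(\pm)}_{H(\Lambda^{[-1,2]})}(\tau,z)\big\}$$ (for each of the two signs, the same sign throughout), for $(\tau,z)\in\mathbb{C}_+\times\mathbb{C}$.
   Context: Notation: $\mathbb{C}_+$ is the upper half-plane, $q^a:=e^{2\pi i a\tau}$, $\eta(\tau)=q^{1/24}\prod_{n\ge1}(1-q^n)$, and for $a,b\in\{0,1\}$ the Mumford theta functions are $\vartheta_{ab}(\tau,z)=\sum_{n\in\mathbb{Z}}e^{\pi i\tau(n+\frac a2)^2+2\pi i(n+\frac a2)(z+\frac b2)}$. For $m\in\frac12\mathbb{N}$, $s\in\frac12\mathbb{Z}$ put $\Phi_1^{[m,s]}(\tau,z_1,z_2,t)=e^{-2\pi imt}\sum_{j\in\mathbb{Z}}\frac{e^{2\pi imj(z_1+z_2)+2\pi isz_1}e^{2\pi i\tau(mj^2+sj)}}{1-e^{2\pi iz_1}e^{2\pi ij\tau}}$, $\Phi_2^{[m,s]}(\tau,z_1,z_2,t)=e^{-2\pi imt}\sum_{j\in\mathbb{Z}}\frac{e^{-2\pi imj(z_1+z_2)-2\pi isz_2}e^{2\pi i\tau(mj^2+sj)}}{1-e^{-2\pi iz_2}e^{2\pi ij\tau}}$, $\Phi^{[m,s]}=\Phi_1^{[m,s]}-\Phi_2^{[m,s]}$.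 Let $\theta_{k,m}(\tau,z)=\sum_{j\in\mathbb{Z}}e^{2\pi im(j+\frac{k}{2m})z}e^{2\pi i\tau m(j+\frac{k}{2m})^2}$, $E(x)=2\int_0^xe^{-\pi t^2}dt$, and $R_{j;m}(\tau,w)=\sum_{n\in j+2m\mathbb{Z}}\big\{{\rm sgn}(n-\frac12-j+2m)-E\big((n-2m\frac{{\rm Im}\,w}{{\rm Im}\,\tau})\sqrt{{\rm Im}(\tau)/m}\big)\big\}e^{-\frac{\pi in^2\tau}{2m}+2\pi inw}$. The correction term is $\Phi^{[m,s]}_{\rm add}(\tau,z_1,z_2,t)=-\frac12e^{-2\pi imt}\sum_{k\in s+\mathbb{Z},\,s\le k<s+2m}R_{k;m}(\tau,\frac{z_1-z_2}{2})[\theta_{k,m}-\theta_{-k,m}](\tau,z_1+z_2)$, and the modification is $\widetilde\Phi^{[m,s]}=\Phi^{[m,s]}+\Phi^{[m,s]}_{\rm add}$. N=3 denominators: $R^{(+)}(\tau,z)=\eta(\frac\tau2)\eta(2\tau)\frac{\vartheta_{11}(\tau,z)}{\vartheta_{00}(\tau,z)}$, $R^{(-)}(\tau,z)=\frac{\eta(\tau)^3}{\eta(\frac\tau2)}\frac{\vartheta_{11}(\tau,z)}{\vartheta_{01}(\tau,z)}$. For $m_2\in\{0,1,2\}$ let $H(\Lambda^{[-1,m_2]})$ be the N=3 superconformal module obtained by quantum Hamiltonian reduction of the $\widehat{osp}(3|2)$-module of highest weight $-\Lambda_0-\frac{m_2}{2}\alpha_1$. Its (honest) character and supercharacter are the functions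 of $(\tau,z)$ given by $R^{(+)}{\rm ch}^{(+)}_{H(\Lambda^{[-1,m_2]})}=\Phi^{[1,\frac{m_2+1}2]}(2\tau,z+\frac\tau2-\frac12,z-\frac\tau2+\frac12,\frac\tau8)$ and $R^{(-)}{\rm ch}^{(-)}_{H(\Lambda^{[-1,m_2]})}=\Phi^{[1,\frac{m_2+1}2]}(2\tau,z+\frac\tau2,z-\frac\tau2,\frac\tau8)$. The modified (super)characters $\widetilde{\rm ch}^{(\pm)}$ are defined by the same formulas with $\Phi$ replaced by $\widetilde\Phi$. *)

(* Defs.v *)
From Stdlib Require Import Reals ZArith List.
From Coquelicot Require Import Coquelicot.
Open Scope C_scope.

Definition Cexp (z : C) : C :=
  (exp (Re z) * cos (Im z), exp (Re z) * sin (Im z))%R.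

Definition expi (z : C) : C := Cexp (2 * PI * Ci * z).

Definition CSeries (u : nat -> C) : C :=
  (Series (fun n => Re (u n)), Series (fun n => Im (u n))).

(* All bilateral series below converge absolutely (off the poles of the
   summands), so splitting the sum at 0 is immaterial. *)
Definition sumZ (u : Z -> C) : C :=
  CSeries (fun n => u (Z.of_nat n)) + CSeries (fun n => u (- Z.of_nat n - 1)%Z).

Definition Csum (n : nat) (u : nat -> C) : C :=
  fold_right Cplus 0 (map u (seq 0 n)).

Definition CLim_seq (u : nat -> C) : C :=
  (real (Lim_seq (fun n => Re (u n))), real (Lim_seq (fun n => Im (u n)))).

Definition eta (tau : C) : C :=
  expi (tau / 24) *
  CLim_seq (fun N =>
    fold_right Cmult 1 (map (fun n => 1 - expi (INR n * tau)) (seq 1 N))).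

Definition vartheta (a b : R) (tau z : C) : C :=
  sumZ (fun n =>
    let x : C := IZR n + a / 2 in
    Cexp (PI * Ci * tau * (x * x) + 2 * PI * Ci * x * (z + b / 2))).

(* The parameters m in (1/2)N and s in (1/2)Z are encoded by M = 2m : nat and
   S = 2s : Z. *)
Definition half_nat (M : nat) : R := (INR M / 2)%R.
Definition half_int (S : Z) : R := (IZR S / 2)%R.

Definition Phi1 (M : nat) (S : Z) (tau z1 z2 t : C) : C :=
  let m := half_nat M in let s := half_int S in
  expi (- (m * t)) *
  sumZ (fun k => let j := IZR k in
    expi (m * j * (z1 + z2) + s * z1) * expi (tau * (m * (j * j) + s * j))
    / (1 - expi z1 * expi (j * tau))).

Definition Phi2 (M : nat) (S : Z) (tau z1 z2 t : C) : C :=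
  let m := half_nat M in let s := half_int S in
  expi (- (m * t)) *
  sumZ (fun k => let j := IZR k in
    expi (- (m * j * (z1 + z2)) - s * z2) * expi (tau * (m * (j * j) + s * j))
    / (1 - expi (- z2) * expi (j * tau))).

Definition Phi (M : nat) (S : Z) (tau z1 z2 t : C) : C :=
  Phi1 M S tau z1 z2 t - Phi2 M S tau z1 z2 t.

Definition Phi_nonpole (tau z1 z2 : C) : Prop :=
  forall j : Z,
    1 - expi z1 * expi (IZR j * tau) <> 0 /\
    1 - expi (- z2) * expi (IZR j * tau) <> 0.

Definition theta (k m : R) (tau z : C) : C :=
  sumZ (fun j =>
    let x : C := IZR j + k / (2 * m) in
    expi (m * x * z) * expi (tau * m * (x * x))).

Definition E (x : R) : R := (2 * RInt (fun t => exp (- PI * t ^ 2)) 0 x)%R.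

Definition Rcorr (j : R) (M : nat) (tau w : C) : C :=
  let m := half_nat M in
  sumZ (fun l =>
    let n : R := (j + 2 * m * IZR l)%R in
    RtoC (sign (n - 1 / 2 - j + 2 * m)
          - E ((n - 2 * m * (Im w / Im tau)) * sqrt (Im tau / m)))%R
    * Cexp (- (PI * Ci * (n * n) * tau / (2 * m)) + 2 * PI * Ci * n * w)).

Definition Phi_add (M : nat) (S : Z) (tau z1 z2 t : C) : C :=
  let m := half_nat M in let s := half_int S in
  - (1 / 2) * expi (- (m * t)) *
  Csum M (fun i =>
    let k : R := (s + INR i)%R in
    Rcorr k M tau ((z1 - z2) / 2)
    * (theta k m tau (z1 + z2) - theta (- k) m tau (z1 + z2))).

Definition Phi_mod (M : nat) (S : Z) (tau z1 z2 t : C) : C :=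
  Phi M S tau z1 z2 t + Phi_add M S tau z1 z2 t.

(* Plus: characters; Minus: supercharacters. *)
Inductive pm : Set := Plus | Minus.

Definition vartheta_den (e : pm) (tau z : C) : C :=
  match e with
  | Plus => vartheta 0 0 tau z
  | Minus => vartheta 0 1 tau z
  end.

Definition Rden (e : pm) (tau z : C) : C :=
  match e with
  | Plus => eta (tau / 2) * eta (2 * tau)
  | Minus => eta tau * eta tau * eta tau / eta (tau / 2)
  end * (vartheta 1 1 tau z / vartheta_den e tau z).

Definition shift (e : pm) (tau : C) : C :=
  match e with
  | Plus => tau / 2 - 1 / 2
  | Minus => tau / 2
  end.

(* [F] is [Phi] or [Phi_mod]: the right-hand side of the formula for the
   (super)character of H(Lambda^{[-1,m2]}), with m = 1 and s = (m2 + 1) / 2. *)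
Definition numerator (F : nat -> Z -> C -> C -> C -> C -> C)
    (e : pm) (m2 : nat) (tau z : C) : C :=
  F 2%nat (Z.of_nat m2 + 1)%Z
    (2 * tau) (z + shift e tau) (z - shift e tau) (tau / 8).

Definition regular_point (e : pm) (tau z : C) : Prop :=
  Phi_nonpole (2 * tau) (z + shift e tau) (z - shift e tau) /\
  vartheta_den e tau z <> 0 /\ Rden e tau z <> 0.

(* [ch] is the function on C_+ x C given by Rden * ch = numerator. The points
   of each fibre {tau} x C at which this equation is meaningless or does not
   determine ch are isolated; for m2 = 0, 2 they are removable singularities
   of the quotient (the poles of numerator and the zeros of vartheta_den are
   poles of Rden, and numerator vanishes with vartheta_11), where ch takes the
   limit value. *)
Definition given_by (F : nat -> Z -> C -> C -> C -> C -> C)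
    (e : pm) (m2 : nat) (ch : C -> C -> C) : Prop :=
  forall tau z : C, (0 < Im tau)%R ->
    (regular_point e tau z -> Rden e tau z * ch tau z = numerator F e m2 tau z)
    /\
    (~ regular_point e tau z ->
       filterlim (fun z' : C => numerator F e m2 tau z' / Rden e tau z')
         (locally' z) (locally (ch tau z))).

Definition is_character : pm -> nat -> (C -> C -> C) -> Prop := given_by Phi.
Definition is_modified_character : pm -> nat -> (C -> C -> C) -> Prop :=
  given_by Phi_mod.

(* Main.v *)
(** Raising s by one in Phi_i^{[m,s]} multiplies the j-th numerator by the
    geometric factor x of its denominator 1 - x, so
    Phi^{[m,s+1]} - Phi^{[m,s]} is a multiple of theta_{s,m} - theta_{-s,m}.
    On the specialisation at hand Im w / Im tau = 1/4, and completing the square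
    makes the summands of R_{1/2;1} and R_{3/2;1} odd under l -> -l and
    l -> -l - 1, except for the term l = 0 of the former: thus R_{3/2;1} = 0,
    R_{1/2;1} is one exponential, and
    Phi_add^{[1,1/2]} = (Phi^{[1,3/2]} - Phi^{[1,1/2]}) / 2.
    Absolute convergence of R_{1/2;1} rests on 1 - E(x) <= e^{-pi x^2}, which
    beats the growing factor e^{-pi i n^2 tau / 2m}. Off the regular points both
    sides are limits along a punctured neighbourhood, where nonpoles are
    dense. *)
Require Import Defs.
From Stdlib Require Import Reals ZArith Psatz Classical.
From Coquelicot Require Import Coquelicot.
Local Open Scope R_scope.

(** * The error function *)

Lemma exp_le (x y : R) : x <= y -> exp x <= exp y.
Proof.
  intros [h | ->]; [left; now apply exp_increasing | right; reflexivity].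
Qed.

Lemma continuous_gauss (x : R) : continuous (fun t => exp (- PI * t ^ 2)) x.
Proof.
  apply (ex_derive_continuous (fun t => exp (- PI * t ^ 2))); auto_derive; easy.
Qed.

Lemma ex_RInt_gauss (a b : R) : ex_RInt (fun t => exp (- PI * t ^ 2)) a b.
Proof.
  apply (ex_RInt_continuous (V := R_CompleteNormedModule)); intros.
  apply continuous_gauss.
Qed.

Lemma is_derive_gauss_primitive (x : R) :
  is_derive (fun y => RInt (fun t => exp (- PI * t ^ 2)) 0 y) x
    (exp (- PI * x ^ 2)).
Proof.
  apply (is_derive_RInt (fun t => exp (- PI * t ^ 2)) _ 0 x).
  - apply filter_forall; intros.
    apply (RInt_correct (V := R_CompleteNormedModule)), ex_RInt_gauss.
  - apply continuous_gauss.
Qed.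

Lemma E_opp (x : R) : E (- x) = - E x.
Proof.
  unfold E.
  assert (h := RInt_comp_lin (V := R_CompleteNormedModule)
    (fun t => exp (- PI * t ^ 2)) (-1) 0 0 x (ex_RInt_gauss _ _)).
  replace (-1 * 0 + 0) with 0 in h by ring.
  replace (-1 * x + 0) with (- x) in h by ring.
  rewrite <- h.
  assert (k := RInt_scal (V := R_CompleteNormedModule)
    (fun t => exp (- PI * t ^ 2)) 0 x (-1) (ex_RInt_gauss _ _)).
  rewrite (RInt_ext _ (fun t => scal (-1) (exp (- PI * t ^ 2)))).
  - transitivity (2 * (-1 * RInt (fun t => exp (- PI * t ^ 2)) 0 x));
      [f_equal; exact k | ring].
  - intros t _; do 3 f_equal; ring.
Qed.

(** The classical auxiliary integrand for Gauss's integral: differentiating in [x] cancels the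
    denominator and leaves a Gaussian in [x * t], while [x = 0] gives the derivative of the
    arctangent. *)
Definition gauss_aux (x t : R) : R :=
  exp (- PI * x ^ 2 * (1 + t ^ 2)) / (1 + t ^ 2).

Lemma is_derive_gauss_aux (x t : R) :
  is_derive (fun y => gauss_aux y t) x
    (- 2 * PI * x * exp (- PI * x ^ 2 * (1 + t ^ 2))).
Proof.
  unfold gauss_aux; auto_derive; [nra |].
  replace (- PI * (x * (x * 1)) * (1 + t * (t * 1))) with
    (- PI * x ^ 2 * (1 + t ^ 2)) by ring.
  field; nra.
Qed.

Lemma ex_RInt_gauss_aux (x a b : R) : ex_RInt (gauss_aux x) a b.
Proof.
  apply (ex_RInt_continuous (V := R_CompleteNormedModule)); intros t _.
  apply (ex_derive_continuous (gauss_aux x)); unfold gauss_aux; auto_derive; nra.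
Qed.

(** Differentiation under the integral sign, then the substitution u = x t, whose Jacobian is the
    factor [x] of the integrand's derivative. *)
Lemma is_derive_RInt_gauss_aux (x : R) :
  is_derive (fun y => RInt (gauss_aux y) 0 1) x
    (- 2 * PI * exp (- PI * x ^ 2) * RInt (fun t => exp (- PI * t ^ 2)) 0 x).
Proof.
  replace (- 2 * PI * exp (- PI * x ^ 2) * RInt (fun t => exp (- PI * t ^ 2)) 0 x)
    with (RInt (fun t => Derive (fun u => gauss_aux u t) x) 0 1).
  - apply (is_derive_RInt_param gauss_aux 0 1 x).
    + apply filter_forall; intros y t _; eexists; apply is_derive_gauss_aux.
    + intros t _.
      apply continuity_2d_pt_ext with
        (fun u v => - 2 * PI * u * exp (- PI * u ^ 2 * (1 + v ^ 2))).
      { intros u v; symmetry; apply is_derive_unique, is_derive_gauss_aux. }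
      apply continuity_2d_pt_mult.
      * apply continuity_2d_pt_mult;
          [apply continuity_2d_pt_const | apply continuity_2d_pt_id1].
      * apply (continuity_1d_2d_pt_comp exp).
        { apply derivable_continuous_pt, derivable_pt_exp. }
        apply continuity_2d_pt_ext with (fun u v => - PI * (u * u) * (1 + v * v)).
        { intros; ring. }
        repeat first [ apply continuity_2d_pt_mult | apply continuity_2d_pt_plus
          | apply continuity_2d_pt_const | apply continuity_2d_pt_id1
          | apply continuity_2d_pt_id2 ].
    + apply filter_forall; intros y; apply ex_RInt_gauss_aux.
  - assert (h := RInt_comp_lin (V := R_CompleteNormedModule)
      (fun t => exp (- PI * t ^ 2)) x 0 0 1 (ex_RInt_gauss _ _)).
    replace (x * 0 + 0) with 0 in h by ring.
    replace (x * 1 + 0) with x in h by ring.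
    rewrite <- h.
    assert (k := RInt_scal (V := R_CompleteNormedModule)
      (fun t => scal x (exp (- PI * (x * t + 0) ^ 2))) 0 1
      (- 2 * PI * exp (- PI * x ^ 2))).
    etransitivity; [| apply k].
    + apply RInt_ext; intros t _.
      etransitivity; [apply is_derive_unique, is_derive_gauss_aux |].
      replace (- PI * x ^ 2 * (1 + t ^ 2)) with
        (- PI * x ^ 2 + - PI * (x * t + 0) ^ 2) by ring.
      rewrite exp_plus; unfold scal; simpl; unfold mult; simpl; ring.
    + apply (ex_RInt_comp_lin (V := R_CompleteNormedModule)
        (fun t => exp (- PI * t ^ 2)) x 0 0 1), ex_RInt_gauss.
Qed.

(* The derivative of the left-hand side vanishes: Gauss's integral without
   polar coordinates. *)
Lemma gauss_identity (x : R) : 0 <= x ->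
  RInt (fun t => exp (- PI * t ^ 2)) 0 x ^ 2 + RInt (gauss_aux x) 0 1 / PI
  = 1 / 4.
Proof.
  assert (hpi := PI_RGT_0).
  set (F := fun x => RInt (fun t => exp (- PI * t ^ 2)) 0 x ^ 2
    + RInt (gauss_aux x) 0 1 / PI).
  assert (hF : forall y, is_derive F y 0).
  { intros y; unfold F.
    assert (h1 := is_derive_gauss_primitive y).
    assert (h2 := is_derive_RInt_gauss_aux y).
    evar_last.
    - apply (is_derive_plus (V := R_NormedModule)
        (fun x => RInt (fun t => exp (- PI * t ^ 2)) 0 x ^ 2)
        (fun x => RInt (gauss_aux x) 0 1 / PI)).
      + apply (is_derive_pow _ 2 _ _ h1).
      + apply (is_derive_ext (fun x => scal (/ PI) (RInt (gauss_aux x) 0 1))).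
        * intros t; unfold scal; simpl; unfold mult; simpl; unfold Rdiv; ring.
        * apply (is_derive_scal (fun x => RInt (gauss_aux x) 0 1) y (/ PI) _ h2).
    - unfold plus, scal; simpl; unfold mult; simpl; field; lra. }
  (* At 0 only the arctangent integral is left: (atan 1 - atan 0) / PI = 1/4. *)
  assert (hF0 : F 0 = 1 / 4).
  { unfold F; rewrite RInt_point.
    replace (RInt (gauss_aux 0) 0 1) with (PI / 4).
    - unfold zero; simpl; field; lra.
    - symmetry; apply is_RInt_unique.
      apply (is_RInt_ext (fun t => / (1 + t²))).
      { intros t _; unfold gauss_aux, Rsqr.
        replace (- PI * 0 ^ 2 * (1 + t ^ 2)) with 0 by ring.
        rewrite exp_0; match goal with |- ?a = ?b => change (@eq R a b) end; field; nra. }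
      replace (PI / 4) with (minus (atan 1) (atan 0))
        by (rewrite atan_1, atan_0; unfold minus, plus, opp; simpl; ring).
      apply (is_RInt_derive (V := R_CompleteNormedModule) atan).
      + intros t _; apply is_derive_atan.
      + intros t _.
        apply (ex_derive_continuous (fun t => / (1 + t²))).
        unfold Rsqr; auto_derive; nra. }
  intros [hx | <-]; [| exact hF0].
  change (F x = 1 / 4).
  rewrite <- hF0; symmetry; apply (eq_is_derive (V := R_NormedModule) F 0 x); auto.
Qed.

(** With J the integral of [gauss_aux x], [gauss_identity] reads (1 - E x)(1 + E x) = 4 J / PI.
    Bounding 1 + t^2 below by 1 in the exponent gives 0 <= J <= e^{-PI x^2} PI / 4, and 1 + E x >= 1
    carries both bounds over to 1 - E x. *)
Lemma E_bounds (x : R) : 0 <= x -> 0 <= 1 - E x <= exp (- PI * x ^ 2).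
Proof.
  intros hx.
  assert (hpi := PI_RGT_0).
  assert (hI := gauss_identity x hx).
  assert (h0 : RInt (gauss_aux 0) 0 1 = PI / 4).
  { assert (h := gauss_identity 0 (Rle_refl 0)).
    rewrite RInt_point in h; unfold zero in h; simpl in h.
    assert (RInt (gauss_aux 0) 0 1 / PI * PI = 1 / 4 * PI) by (f_equal; lra).
    field_simplify in H; lra. }
  assert (hpos : 0 <= RInt (gauss_aux x) 0 1).
  { apply RInt_ge_0; [lra | apply ex_RInt_gauss_aux |].
    intros t _; unfold gauss_aux; apply Rlt_le, Rdiv_lt_0_compat;
      [apply exp_pos | nra]. }
  assert (hle : RInt (gauss_aux x) 0 1 <= exp (- PI * x ^ 2) * (PI / 4)).
  { rewrite <- h0.
    assert (k := RInt_scal (V := R_CompleteNormedModule) (gauss_aux 0) 0 1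
      (exp (- PI * x ^ 2)) (ex_RInt_gauss_aux 0 0 1)).
    apply Rle_trans with (RInt (fun t => scal (exp (- PI * x ^ 2)) (gauss_aux 0 t)) 0 1).
    2: { right; exact k. }
    apply RInt_le; [lra | apply ex_RInt_gauss_aux | |].
    - apply (ex_RInt_scal (V := R_CompleteNormedModule)), ex_RInt_gauss_aux.
    - intros t _; unfold gauss_aux, scal; simpl; unfold mult; simpl.
      replace (- PI * (0 * (0 * 1)) * (1 + t * (t * 1))) with 0 by ring.
      rewrite exp_0.
      unfold Rdiv; rewrite Rmult_1_l.
      apply Rmult_le_compat_r; [left; apply Rinv_0_lt_compat; nra |].
      apply exp_le.
      assert (0 <= PI * (x * (x * 1)) * (t * (t * 1)));
        [apply Rmult_le_pos; [apply Rmult_le_pos |]; nra | nra]. }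
  assert (hE : 0 <= RInt (fun t => exp (- PI * t ^ 2)) 0 x).
  { apply RInt_ge_0; [lra | apply ex_RInt_gauss |].
    intros; left; apply exp_pos. }
  unfold E; set (I := RInt (fun t => exp (- PI * t ^ 2)) 0 x : R) in *.
  set (J := RInt (gauss_aux x) 0 1 : R) in *.
  assert (0 <= J / PI) by (apply Rdiv_le_0_compat; lra).
  assert (J / PI <= exp (- PI * x ^ 2) / 4).
  { apply Rmult_le_reg_r with PI; [lra |].
    replace (J / PI * PI) with J by (field; lra). lra. }
  split; nra.
Qed.

(** * Bilateral series *)

(** Domination by a geometric series of ratio e^{-1} stands in for absolute convergence: every
    Gaussian series below satisfies it, and it survives reindexing and division by denominators
    bounded away from 0. *)
Definition Csummable (u : nat -> C) : Prop :=
  exists A, forall n, Cmod (u n) <= A * exp (- INR n).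

Definition summable (u : Z -> C) : Prop :=
  exists A, forall k, Cmod (u k) <= A * exp (- Rabs (IZR k)).

Lemma im_le_Cmod (c : C) : Rabs (Im c) <= Cmod c.
Proof. eapply Rle_trans; [apply Rmax_r | apply Rmax_Cmod]. Qed.

Lemma ex_series_exp_bound (a : nat -> R) (A : R) :
  (forall n, Rabs (a n) <= A * exp (- INR n)) -> ex_series a.
Proof.
  intros h; apply (ex_series_le (K := R_AbsRing) (V := R_CompleteNormedModule) a
    (fun n => scal A (exp (-1) ^ n))).
  - intros n; replace (scal A (exp (-1) ^ n)) with (A * exp (- INR n)); [apply h |].
    unfold scal; simpl; unfold mult; simpl; f_equal.
    induction n as [| n IH].
    + simpl; rewrite Ropp_0; apply exp_0.
    + rewrite S_INR; replace (- (INR n + 1)) with (-1 + - INR n) by ring.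
      now rewrite exp_plus, IH.
  - apply (ex_series_scal (K := R_AbsRing) (V := R_NormedModule)), ex_series_geom.
    assert (h0 := exp_pos (-1)); assert (exp (-1) < exp 0) by (apply exp_increasing; lra).
    rewrite exp_0 in *; rewrite Rabs_pos_eq; lra.
Qed.

Lemma Csummable_ex (u : nat -> C) : Csummable u ->
  ex_series (fun n => Re (u n)) /\ ex_series (fun n => Im (u n)).
Proof.
  intros [A h]; split; apply ex_series_exp_bound with A; intros n;
    (eapply Rle_trans; [| apply h]); [apply re_le_Cmod | apply im_le_Cmod].
Qed.

Lemma CSeries_minus (u v : nat -> C) : Csummable u -> Csummable v ->
  CSeries (fun n => u n - v n)%C = (CSeries u - CSeries v)%C.
Proof.
  intros hu hv; apply Csummable_ex in hu as [hu1 hu2]; apply Csummable_ex in hv as [hv1 hv2].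
  unfold CSeries; apply injective_projections; simpl;
    match goal with |- _ = ?x + - ?y => change (x + - y) with (x - y) end;
    rewrite <- Series_minus by assumption; apply Series_ext; reflexivity.
Qed.

Lemma CSeries_scal (c : C) (u : nat -> C) : Csummable u ->
  CSeries (fun n => c * u n)%C = (c * CSeries u)%C.
Proof.
  intros hu; apply Csummable_ex in hu as [hu1 hu2].
  unfold CSeries; apply injective_projections; simpl; rewrite <- !Series_scal_l.
  - rewrite <- Series_minus; [reflexivity | |];
      apply (ex_series_scal (K := R_AbsRing) (V := R_NormedModule)); assumption.
  - rewrite <- Series_plus; [reflexivity | |];
      apply (ex_series_scal (K := R_AbsRing) (V := R_NormedModule)); assumption.
Qed.

Lemma CSeries_ext (u v : nat -> C) : (forall n, u n = v n) -> CSeries u = CSeries v.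
Proof.
  intros h; unfold CSeries; f_equal; apply Series_ext; intros; now rewrite h.
Qed.

Lemma CSeries_opp (u : nat -> C) : CSeries (fun n => - u n)%C = (- CSeries u)%C.
Proof.
  unfold CSeries; apply injective_projections; simpl; rewrite <- Series_opp;
    reflexivity.
Qed.

Lemma CSeries_incr_1 (u : nat -> C) : Csummable u ->
  CSeries u = (u 0%nat + CSeries (fun n => u (S n)))%C.
Proof.
  intros hu; apply Csummable_ex in hu as [hu1 hu2].
  unfold CSeries; apply injective_projections; simpl;
    rewrite Series_incr_1 by assumption; reflexivity.
Qed.

Lemma summable_half (u : Z -> C) (f : nat -> Z) : summable u ->
  (forall n, INR n <= Rabs (IZR (f n))) -> Csummable (fun n => u (f n)).
Proof.
  intros [A h] hf; exists A; intros n; eapply Rle_trans; [apply h |].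
  apply Rmult_le_compat_l.
  (* The bound at index 0 forces [A] to be nonnegative. *)
  - assert (h0 := h 0%Z); assert (h1 := Cmod_ge_0 (u 0%Z)).
    replace (- Rabs (IZR 0)) with 0 in h0 by (rewrite Rabs_R0; ring).
    rewrite exp_0 in h0; lra.
  - apply exp_le; specialize (hf n); lra.
Qed.

Lemma INR_le_Rabs_pos (n : nat) : INR n <= Rabs (IZR (Z.of_nat n)).
Proof. rewrite <- INR_IZR_INZ; apply Rle_abs. Qed.

Lemma INR_le_Rabs_neg (n : nat) : INR n <= Rabs (IZR (- Z.of_nat n - 1)).
Proof.
  rewrite minus_IZR, opp_IZR, <- INR_IZR_INZ, Rabs_left1; assert (h := pos_INR n); lra.
Qed.

Lemma summable_pos (u : Z -> C) : summable u -> Csummable (fun n => u (Z.of_nat n)).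
Proof. intros h; apply summable_half; [exact h | apply INR_le_Rabs_pos]. Qed.

Lemma summable_neg (u : Z -> C) : summable u ->
  Csummable (fun n => u (- Z.of_nat n - 1)%Z).
Proof. intros h; apply summable_half; [exact h | apply INR_le_Rabs_neg]. Qed.

Lemma sumZ_ext (u v : Z -> C) : (forall k, u k = v k) -> sumZ u = sumZ v.
Proof. intros h; unfold sumZ; f_equal; apply CSeries_ext; auto. Qed.

Lemma sumZ_minus (u v : Z -> C) : summable u -> summable v ->
  sumZ (fun k => u k - v k)%C = (sumZ u - sumZ v)%C.
Proof.
  intros hu hv; unfold sumZ.
  rewrite (CSeries_minus (fun n => u (Z.of_nat n)) (fun n => v (Z.of_nat n)))
    by now apply summable_pos.
  rewrite (CSeries_minus (fun n => u (- Z.of_nat n - 1)%Z)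
    (fun n => v (- Z.of_nat n - 1)%Z)) by now apply summable_neg.
  ring.
Qed.

Lemma sumZ_scal (c : C) (u : Z -> C) : summable u ->
  sumZ (fun k => c * u k)%C = (c * sumZ u)%C.
Proof.
  intros hu; unfold sumZ.
  rewrite (CSeries_scal c (fun n => u (Z.of_nat n))) by now apply summable_pos.
  rewrite (CSeries_scal c (fun n => u (- Z.of_nat n - 1)%Z)) by now apply summable_neg.
  ring.
Qed.

(** The halves k >= 0 and k <= -1 of [sumZ] are not exchanged by k -> -k, so the term at 0 is split
    off on both sides before the tails are matched. *)
Lemma sumZ_opp_index (u : Z -> C) : summable u -> sumZ (fun k => u (- k)%Z) = sumZ u.
Proof.
  intros hu; unfold sumZ.
  rewrite (CSeries_incr_1 (fun n => u (Z.of_nat n))) by now apply summable_pos.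
  rewrite (CSeries_incr_1 (fun n => u (- Z.of_nat n)%Z)).
  - change (Z.of_nat 0) with 0%Z; change (- 0)%Z with 0%Z.
    rewrite (CSeries_ext (fun n => u (- (- Z.of_nat n - 1))%Z)
      (fun n => u (Z.of_nat (S n)))).
    + rewrite (CSeries_ext (fun n => u (- Z.of_nat (S n))%Z)
        (fun n => u (- Z.of_nat n - 1)%Z)); [ring |].
      intros n; f_equal; lia.
    + intros n; f_equal; lia.
  - apply (summable_half u (fun n => (- Z.of_nat n)%Z)); [exact hu |].
    intros n; rewrite opp_IZR, Rabs_Ropp; apply INR_le_Rabs_pos.
Qed.

(** Oddness is asked only away from 0, so the central term survives; this is the situation of
    R_{1/2;1}. *)
Lemma sumZ_odd (u : Z -> C) : summable u ->
  (forall k, k <> 0%Z -> u (- k)%Z = (- u k)%C) -> sumZ u = u 0%Z.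
Proof.
  intros hu hodd; unfold sumZ.
  rewrite (CSeries_incr_1 (fun n => u (Z.of_nat n))) by now apply summable_pos.
  rewrite (CSeries_ext (fun n => u (- Z.of_nat n - 1)%Z)
    (fun n => - u (Z.of_nat (S n)))%C).
  - rewrite (CSeries_opp (fun n => u (Z.of_nat (S n)))); change (Z.of_nat 0) with 0%Z; ring.
  - intros n; rewrite <- hodd by lia; f_equal; lia.
Qed.

(** The involution k -> -k - 1 exchanges the two halves of [sumZ] term by term, so they are
    opposite. This is the situation of R_{3/2;1}. *)
Lemma sumZ_half_odd (u : Z -> C) :
  (forall k, u (- k - 1)%Z = (- u k)%C) -> sumZ u = 0%C.
Proof.
  intros hodd; unfold sumZ.
  rewrite (CSeries_ext (fun n => u (- Z.of_nat n - 1)%Z) (fun n => - u (Z.of_nat n))%C)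
    by auto.
  rewrite (CSeries_opp (fun n => u (Z.of_nat n))); ring.
Qed.

Lemma summable_quadratic (u : Z -> C) (A p q : R) : 0 < p ->
  (forall k, Cmod (u k) <= A * exp (- (p * (IZR k * IZR k) + q * IZR k))) ->
  summable u.
Proof.
  intros hp h.
  (* The exponent of the constant is the maximum of (|q| + 1) x - p x^2 over real x; the extra 1
     pays for the factor e^{-|k|}. *)
  exists (A * exp ((Rabs q + 1) ^ 2 / (4 * p))); intros k.
  eapply Rle_trans; [apply h |]; rewrite Rmult_assoc, <- exp_plus.
  apply Rmult_le_compat_l.
  - assert (h0 := h 0%Z); assert (h1 := Cmod_ge_0 (u 0%Z)).
    replace (- (p * (IZR 0 * IZR 0) + q * IZR 0)) with 0 in h0 by (simpl; ring).
    rewrite exp_0 in h0; lra.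
  - apply exp_le.
    assert (h2 : - (q * IZR k) <= Rabs q * Rabs (IZR k)).
    { rewrite <- Rabs_mult, <- Rabs_Ropp; apply Rle_abs. }
    assert (h3 : IZR k * IZR k = Rabs (IZR k) * Rabs (IZR k)).
    { rewrite <- Rabs_mult, Rabs_pos_eq; [reflexivity | apply Rle_0_sqr]. }
    rewrite h3; set (x := Rabs (IZR k)) in *; set (b := Rabs q) in *.
    assert (h4 : 0 <= p * (x - (b + 1) / (2 * p)) ^ 2)
      by (apply Rmult_le_pos; [lra | apply pow2_ge_0]).
    assert (h5 : p * (x - (b + 1) / (2 * p)) ^ 2 =
      p * (x * x) - (b + 1) * x + (b + 1) ^ 2 / (4 * p)) by (field; lra).
    lra.
Qed.

(** * The complex exponential *)

Lemma Cexp_plus (a b : C) : Cexp (a + b) = (Cexp a * Cexp b)%C.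
Proof.
  unfold Cexp, Cmult; change (Re (a + b)) with (Re a + Re b);
    change (Im (a + b)) with (Im a + Im b); cbn [fst snd].
  rewrite exp_plus, cos_plus, sin_plus; f_equal; ring.
Qed.

Lemma Cmod_Cexp (z : C) : Cmod (Cexp z) = exp (Re z).
Proof.
  unfold Cmod, Cexp; simpl fst; simpl snd.
  transitivity (sqrt (exp (Re z))²); [f_equal | apply sqrt_Rsqr; left; apply exp_pos].
  transitivity ((exp (Re z))² * ((sin (Im z))² + (cos (Im z))²)); [unfold Rsqr; ring |].
  rewrite sin2_cos2; ring.
Qed.

Lemma Cexp_0 : Cexp 0 = 1%C.
Proof. unfold Cexp; simpl; rewrite exp_0, cos_0, sin_0; unfold RtoC; f_equal; ring. Qed.

Lemma Cexp_period (z : C) (k : Z) : Cexp (z + 2 * PI * Ci * IZR k) = Cexp z.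
Proof.
  assert (h : forall (n : nat) w, Cexp (w + 2 * PI * Ci * INR n) = Cexp w).
  { intros n [a b]; unfold Cexp.
    replace (Re ((a, b) + 2 * PI * Ci * INR n)%C) with (Re (a, b)) by (simpl; ring).
    replace (Im ((a, b) + 2 * PI * Ci * INR n)%C) with (Im (a, b) + 2 * INR n * PI)
      by (simpl; ring).
    now rewrite cos_period, sin_period. }
  destruct (Z.le_ge_cases 0 k) as [hk | hk].
  - rewrite <- (h (Z.to_nat k) z), INR_IZR_INZ, Z2Nat.id by easy; reflexivity.
  - rewrite <- (h (Z.to_nat (- k)) (z + 2 * PI * Ci * IZR k)%C), INR_IZR_INZ,
      Z2Nat.id, opp_IZR, RtoC_opp by lia.
    f_equal; ring.
Qed.

Lemma expi_plus (a b : C) : expi (a + b) = (expi a * expi b)%C.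
Proof. unfold expi; rewrite <- Cexp_plus; f_equal; ring. Qed.

Lemma Cmod_expi (z : C) : Cmod (expi z) = exp (- (2 * PI * Im z)).
Proof. destruct z; unfold expi; rewrite Cmod_Cexp; f_equal; simpl; ring. Qed.

(** * The functions Phi and their correction terms *)

Lemma Cmod_one_minus (x : C) : Rabs (1 - Cmod x) <= Cmod (1 - x).
Proof.
  assert (h1 := Cmod_triangle (1 - x) x).
  assert (h2 := Cmod_triangle (- (1 - x)) 1).
  replace (1 - x + x)%C with (1 : C) in h1 by ring.
  replace (- (1 - x) + 1)%C with x in h2 by ring.
  rewrite Cmod_opp, Cmod_1 in *; apply Rabs_le; lra.
Qed.

(* At most one of the [x j] has modulus close to 1. *)
Lemma one_minus_lower_bound (x : Z -> C) (c Y : R) : 0 < Y ->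
  (forall j, Cmod (x j) = exp (- (2 * PI * (c + IZR j * Y)))) ->
  (forall j, (1 - x j)%C <> 0%C) ->
  exists B, 0 < B /\ forall j, B <= Cmod (1 - x j).
Proof.
  intros hY hmod hnz.
  assert (hpi := PI_RGT_0).
  (* [j0] is the integer nearest to the zero -c/Y of c + j Y, so every other j has |c + j Y| >= Y/2.
     The term at [j0] is merely nonzero and enters the minimum by itself. *)
  set (j0 := up (- c / Y - 1 / 2)).
  destruct (archimed (- c / Y - 1 / 2)) as [ha1 ha2]; fold j0 in ha1, ha2.
  assert (hq : exp (- (PI * Y)) < 1) by (rewrite <- exp_0; apply exp_increasing; nra).
  exists (Rmin (1 - exp (- (PI * Y))) (Cmod (1 - x j0))); split.
  { apply Rmin_glb_lt; [lra | now apply Cmod_gt_0]. }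
  intros j.
  destruct (Z.eq_dec j j0) as [-> | hj]; [apply Rmin_r |].
  eapply Rle_trans; [apply Rmin_l |].
  eapply Rle_trans; [| apply Cmod_one_minus].
  rewrite hmod.
  assert (hc : c = - (- c / Y) * Y) by (field; lra).
  destruct (Z.lt_ge_cases j0 j) as [hlt | hge].
  - assert (h1 : IZR j0 + 1 <= IZR j) by (rewrite <- plus_IZR; apply IZR_le; lia).
    assert (h2 : Y / 2 <= c + IZR j * Y) by (rewrite hc; nra).
    assert (h3 : exp (- (2 * PI * (c + IZR j * Y))) <= exp (- (PI * Y)))
      by (apply exp_le; nra).
    rewrite Rabs_pos_eq; lra.
  - assert (h1 : IZR j + 1 <= IZR j0) by (rewrite <- plus_IZR; apply IZR_le; lia).
    assert (h2 : c + IZR j * Y <= - (Y / 2)) by (rewrite hc; nra).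
    assert (h3 : exp (PI * Y) <= exp (- (2 * PI * (c + IZR j * Y))))
      by (apply exp_le; nra).
    (* For a > 0 one has a - 1 >= 1 - 1/a, so moduli above e^{PI Y} obey the same lower bound as
       those below e^{-PI Y}. *)
    assert (h4 : exp (PI * Y) * exp (- (PI * Y)) = 1)
      by (rewrite <- exp_plus, <- exp_0; f_equal; ring).
    assert (h5 := exp_pos (- (PI * Y))).
    rewrite Rabs_left1; nra.
Qed.

Lemma summable_div (u x : Z -> C) (c Y : R) : 0 < Y ->
  (forall j, Cmod (x j) = exp (- (2 * PI * (c + IZR j * Y)))) ->
  (forall j, (1 - x j)%C <> 0%C) ->
  summable u -> summable (fun j => u j / (1 - x j))%C.
Proof.
  intros hY hmod hnz [A hA].
  destruct (one_minus_lower_bound x c Y hY hmod hnz) as (B & hB & hle).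
  exists (A / B); intros j; rewrite Cmod_div by apply hnz.
  unfold Rdiv; replace (A * / B * exp (- Rabs (IZR j))) with
    (A * exp (- Rabs (IZR j)) * / B) by ring.
  apply Rmult_le_compat; [apply Cmod_ge_0 | | apply hA | apply Rinv_le_contravar; auto].
  left; apply Rinv_0_lt_compat, Cmod_gt_0, hnz.
Qed.

Lemma half_nat_pos (M : nat) : (0 < M)%nat -> 0 < half_nat M.
Proof. intros h; apply lt_INR in h; simpl in h; unfold half_nat; lra. Qed.

Lemma Cmod_expi_mult (tau z : C) (j : Z) :
  Cmod (expi z * expi (IZR j * tau)) = exp (- (2 * PI * (Im z + IZR j * Im tau))).
Proof.
  rewrite Cmod_mult, !Cmod_expi, <- exp_plus; f_equal; destruct tau; simpl; ring.
Qed.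

Definition Phi1_num (m s : R) (tau z1 z2 : C) (k : Z) : C :=
  (expi (m * IZR k * (z1 + z2) + s * z1) *
   expi (tau * (m * (IZR k * IZR k) + s * IZR k)))%C.

Definition Phi2_num (m s : R) (tau z1 z2 : C) (k : Z) : C :=
  (expi (- (m * IZR k * (z1 + z2)) - s * z2) *
   expi (tau * (m * (IZR k * IZR k) + s * IZR k)))%C.

Lemma summable_Phi1_num (m s : R) (tau z1 z2 : C) : 0 < m -> 0 < Im tau ->
  summable (Phi1_num m s tau z1 z2).
Proof.
  intros hm htau; assert (hpi := PI_RGT_0).
  apply summable_quadratic with (A := exp (- (2 * PI * (s * Im z1))))
    (p := 2 * PI * (Im tau * m)) (q := 2 * PI * (m * Im (z1 + z2) + Im tau * s)).
  - apply Rmult_lt_0_compat; [lra | now apply Rmult_lt_0_compat].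
  - intros k; right; unfold Phi1_num; rewrite Cmod_mult, !Cmod_expi, <- !exp_plus.
    f_equal; destruct z1, z2, tau; simpl; ring.
Qed.

Lemma summable_Phi2_num (m s : R) (tau z1 z2 : C) : 0 < m -> 0 < Im tau ->
  summable (Phi2_num m s tau z1 z2).
Proof.
  intros hm htau; assert (hpi := PI_RGT_0).
  apply summable_quadratic with (A := exp (2 * PI * (s * Im z2)))
    (p := 2 * PI * (Im tau * m)) (q := 2 * PI * (- m * Im (z1 + z2) + Im tau * s)).
  - apply Rmult_lt_0_compat; [lra | now apply Rmult_lt_0_compat].
  - intros k; right; unfold Phi2_num; rewrite Cmod_mult, !Cmod_expi, <- !exp_plus.
    f_equal; destruct z1, z2, tau; simpl; ring.
Qed.

Lemma summable_Phi1 (m s : R) (tau z1 z2 : C) : 0 < m -> 0 < Im tau ->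
  Phi_nonpole tau z1 z2 ->
  summable (fun k => Phi1_num m s tau z1 z2 k / (1 - expi z1 * expi (IZR k * tau)))%C.
Proof.
  intros hm htau hp.
  apply (summable_div _ (fun k => (expi z1 * expi (IZR k * tau))%C) (Im z1) (Im tau));
    [exact htau | apply Cmod_expi_mult | apply hp | now apply summable_Phi1_num].
Qed.

Lemma summable_Phi2 (m s : R) (tau z1 z2 : C) : 0 < m -> 0 < Im tau ->
  Phi_nonpole tau z1 z2 ->
  summable (fun k => Phi2_num m s tau z1 z2 k / (1 - expi (- z2) * expi (IZR k * tau)))%C.
Proof.
  intros hm htau hp.
  apply (summable_div _ (fun k => (expi (- z2) * expi (IZR k * tau))%C)
      (Im (- z2)) (Im tau));
    [exact htau | apply Cmod_expi_mult | apply hp | now apply summable_Phi2_num].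
Qed.

(* [Phi1_num] and [Phi2_num] are the terms of theta_{s,m} and theta_{-s,m}
   times [expi (theta_exponent m s tau z1 z2)], after reindexing j -> -j in the
   second case. *)
Definition theta_exponent (m s : R) (tau z1 z2 : C) : C :=
  (s * ((z1 - z2) / 2) - tau * (s * s / (4 * m)))%C.

Lemma expi_opp_r (z : C) : (expi z * expi (- z))%C = 1%C.
Proof.
  rewrite <- expi_plus; replace (z + - z)%C with (0 : C) by ring.
  unfold expi; rewrite Cmult_0_r; apply Cexp_0.
Qed.

(** Complete the square, m j^2 + s j = m (j + s/(2m))^2 - s^2/(4m), and split s z1 = s (z1 + z2)/2 +
    s (z1 - z2)/2. *)
Lemma sumZ_Phi1_num (m s : R) (tau z1 z2 : C) : 0 < m -> 0 < Im tau ->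
  sumZ (Phi1_num m s tau z1 z2) =
  (expi (theta_exponent m s tau z1 z2) * theta s m tau (z1 + z2))%C.
Proof.
  intros hm htau.
  assert (hm0 : RtoC m <> 0%C) by (intros h; apply RtoC_inj in h; lra).
  replace (theta s m tau (z1 + z2)) with
    (expi (- theta_exponent m s tau z1 z2) * sumZ (Phi1_num m s tau z1 z2))%C.
  { rewrite Cmult_assoc, expi_opp_r; ring. }
  rewrite <- sumZ_scal by now apply summable_Phi1_num.
  apply sumZ_ext; intros k; unfold Phi1_num, theta_exponent; rewrite <- !expi_plus.
  f_equal; field; auto.
Qed.

(** After j -> -j the square is centred at s/(2m), and -s z2 = -s (z1 + z2)/2 + s (z1 - z2)/2 yields
    the same prefactor as for [Phi1_num], so that the two theta series can be subtracted. *)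
Lemma sumZ_Phi2_num (m s : R) (tau z1 z2 : C) : 0 < m -> 0 < Im tau ->
  sumZ (Phi2_num m s tau z1 z2) =
  (expi (theta_exponent m s tau z1 z2) * theta (- s) m tau (z1 + z2))%C.
Proof.
  intros hm htau.
  assert (hm0 : RtoC m <> 0%C) by (intros h; apply RtoC_inj in h; lra).
  replace (theta (- s) m tau (z1 + z2)) with
    (expi (- theta_exponent m s tau z1 z2) * sumZ (Phi2_num m s tau z1 z2))%C.
  { rewrite Cmult_assoc, expi_opp_r; ring. }
  rewrite <- sumZ_opp_index by now apply summable_Phi2_num.
  rewrite <- (sumZ_scal _ (fun k => Phi2_num m s tau z1 z2 (- k)%Z)).
  - apply sumZ_ext; intros k; unfold Phi2_num, theta_exponent; rewrite <- !expi_plus.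
    rewrite opp_IZR, !RtoC_opp; f_equal; field; auto.
  - destruct (summable_Phi2_num m s tau z1 z2 hm htau) as [A h]; exists A; intros k.
    rewrite <- Rabs_Ropp, <- opp_IZR; apply h.
Qed.

(* Raising [s] by one multiplies the j-th numerator by the [x] of its
   denominator [1 - x], so the difference telescopes to a theta series. *)
Lemma Phi_shift (M : nat) (S : Z) (tau z1 z2 t : C) :
  (0 < M)%nat -> 0 < Im tau -> Phi_nonpole tau z1 z2 ->
  let m := half_nat M in let s := half_int S in
  (Phi M (S + 2) tau z1 z2 t - Phi M S tau z1 z2 t)%C =
  (- expi (- (m * t)) * expi (theta_exponent m s tau z1 z2) *
   (theta s m tau (z1 + z2) - theta (- s) m tau (z1 + z2)))%C.
Proof.
  intros hM htau hp m s.
  assert (hm : 0 < m) by now apply half_nat_pos.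
  (* [S] encodes 2s, so raising s by one adds 2. *)
  assert (hs : half_int (S + 2) = s + 1).
  { unfold s, half_int; rewrite plus_IZR; field. }
  (* Here [u] and [v] are the quotients for s and s + 1, with numerators c and c x; (x - 1)/(1 - x)
     = -1 leaves only c. *)
  assert (h1 : forall u v c, summable u -> summable v ->
    (forall k, (v k - u k)%C = (-1 * c k)%C) -> summable c ->
    (sumZ v - sumZ u)%C = (- sumZ c)%C).
  { intros u v c hu hv heq hc; rewrite <- sumZ_minus by assumption.
    rewrite (sumZ_ext _ _ heq), sumZ_scal by assumption; ring. }
  assert (e1 : (sumZ (fun k => Phi1_num m (s + 1) tau z1 z2 k
      / (1 - expi z1 * expi (IZR k * tau)))
    - sumZ (fun k => Phi1_num m s tau z1 z2 k / (1 - expi z1 * expi (IZR k * tau)))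
    = - sumZ (Phi1_num m s tau z1 z2))%C).
  { apply h1; [now apply summable_Phi1 .. | | now apply summable_Phi1_num].
    intros k; destruct (hp k) as [hk _].
    replace (Phi1_num m (s + 1) tau z1 z2 k) with
      (Phi1_num m s tau z1 z2 k * (expi z1 * expi (IZR k * tau)))%C; [field; auto |].
    unfold Phi1_num; rewrite <- !expi_plus, RtoC_plus; f_equal; ring. }
  assert (e2 : (sumZ (fun k => Phi2_num m (s + 1) tau z1 z2 k
      / (1 - expi (- z2) * expi (IZR k * tau)))
    - sumZ (fun k => Phi2_num m s tau z1 z2 k / (1 - expi (- z2) * expi (IZR k * tau)))
    = - sumZ (Phi2_num m s tau z1 z2))%C).
  { apply h1; [now apply summable_Phi2 .. | | now apply summable_Phi2_num].
    intros k; destruct (hp k) as [_ hk].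
    replace (Phi2_num m (s + 1) tau z1 z2 k) with
      (Phi2_num m s tau z1 z2 k * (expi (- z2) * expi (IZR k * tau)))%C; [field; auto |].
    unfold Phi2_num; rewrite <- !expi_plus, RtoC_plus; f_equal; ring. }
  rewrite sumZ_Phi1_num in e1 by assumption.
  rewrite sumZ_Phi2_num in e2 by assumption.
  unfold Phi, Phi1, Phi2; rewrite hs; fold m s; cbv zeta.
  unfold Phi1_num in e1; unfold Phi2_num in e2.
  match goal with |- (?a * ?A1 - ?a * ?A2 - (?a * ?B1 - ?a * ?B2))%C = _ =>
    transitivity (a * ((A1 - B1) - (A2 - B2)))%C; [ring |] end.
  rewrite e1, e2; ring.
Qed.

(** * The correction term at the specialisation *)

(* With Im w / Im tau = 1/4 and k = 1/2 + i, the argument of [E] is 2l + i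
   up to scale, and completing the square centres the Gaussian there too. *)
Definition Rcorr_term (i d : R) (tau : C) (l : Z) : C :=
  (RtoC (sign (2 * IZR l + 3 / 2) - E ((2 * IZR l + i) * sqrt (Im tau)))%R *
   Cexp (- (PI * Ci * tau / 2 * ((2 * IZR l + i) * (2 * IZR l + i)))
     + (PI * Ci * tau / 8 - PI * Ci * d * (1 / 2 + i))))%C.

Lemma Rcorr_eq (i : R) (D : Z) (tau : C) : 0 < Im tau ->
  Rcorr (1 / 2 + i) 2 tau (tau / 4 - IZR D / 2) = sumZ (Rcorr_term i (IZR D) tau).
Proof.
  intros htau; unfold Rcorr; apply sumZ_ext; intros l; unfold Rcorr_term.
  assert (hm : half_nat 2 = 1) by (unfold half_nat; simpl; lra).
  assert (hw : Im (tau / 4 - IZR D / 2) / Im tau = 1 / 4).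
  { destruct tau as [a b]; simpl in *; field; lra. }
  rewrite hm, hw; cbv zeta.
  f_equal.
  - do 2 f_equal; [f_equal; field |]. f_equal; f_equal; [field | f_equal; field].
  (* The shift -D/2 of w multiplies the term by e^{-PI i n D} with n = 1/2 + i + 2l; the part 2l
     contributes a full period. *)
  - rewrite <- (Cexp_period _ (D * l)), mult_IZR; f_equal.
    rewrite !RtoC_plus, !RtoC_mult, RtoC_div by lra; field.
Qed.

(** The exponential grows like e^{2 PI l^2 Im tau}, while [E_bounds] makes the bracket at most e^{-4
    PI l^2 Im tau}; the product still decays like a Gaussian. *)
Lemma summable_Rcorr_term (d : R) (tau : C) : 0 < Im tau ->
  summable (Rcorr_term 0 d tau).
Proof.
  intros htau; assert (hpi := PI_RGT_0).
  apply summable_quadratic with (A := exp (- (PI * Im tau / 8)))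
    (p := 2 * PI * Im tau) (q := 0).
  { apply Rmult_lt_0_compat; lra. }
  intros l; unfold Rcorr_term; rewrite Cmod_mult, Cmod_R, Cmod_Cexp, Rplus_0_r.
  assert (hb : Rabs (sign (2 * IZR l + 3 / 2) - E (2 * IZR l * sqrt (Im tau)))
    <= exp (- PI * (2 * IZR l * sqrt (Im tau)) ^ 2)).
  { assert (hs := sqrt_pos (Im tau)).
    (* The offset 3/2 makes the sign +1 for l >= 0, including l = 0, and -1 for l <= -1, in
       agreement with the sign of the argument of [E]. *)
    destruct (Z.le_gt_cases 0 l) as [hl | hl].
    - apply IZR_le in hl.
      rewrite sign_eq_1, Rabs_pos_eq by (try apply E_bounds; nra).
      apply E_bounds; nra.
    - assert (hl' : IZR l <= -1) by (apply IZR_le; lia).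
      rewrite sign_eq_m1 by lra.
      replace (2 * IZR l * sqrt (Im tau)) with (- (- (2 * IZR l * sqrt (Im tau)))) by ring.
      rewrite E_opp.
      set (x := - (2 * IZR l * sqrt (Im tau))).
      assert (hx : 0 <= x) by (unfold x; nra).
      replace (-1 - - E x) with (- (1 - E x)) by ring.
      replace ((- x) ^ 2) with (x ^ 2) by ring.
      rewrite Rabs_Ropp, Rabs_pos_eq; apply E_bounds; exact hx. }
  eapply Rle_trans; [apply Rmult_le_compat_r; [left; apply exp_pos | exact hb] |].
  rewrite <- !exp_plus; right; f_equal.
  rewrite Rpow_mult_distr, pow2_sqrt by lra.
  destruct tau as [a b]; simpl; field.
Qed.

Lemma RtoC_mult_opp (a b : R) (x y : C) :
  a = - b -> x = y -> (a * x)%C = (- (b * y))%C.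
Proof. intros -> ->; rewrite RtoC_opp; ring. Qed.

(** The Gaussian is even in l and the bracket odd except at l = 0, where the sign is 1 and E(0) = 0;
    that single term is the value. *)
Lemma Rcorr_0 (D : Z) (tau : C) : 0 < Im tau ->
  Rcorr (1 / 2) 2 tau (tau / 4 - IZR D / 2) = expi (tau / 16 - IZR D / 4).
Proof.
  intros htau.
  replace (1 / 2) with (1 / 2 + 0) by ring; rewrite Rcorr_eq by exact htau.
  rewrite sumZ_odd; [| now apply summable_Rcorr_term |].
  - unfold Rcorr_term; rewrite sign_eq_1 by lra.
    replace ((2 * 0 + 0) * sqrt (Im tau)) with 0 by ring.
    replace (E 0) with 0 by (unfold E; rewrite RInt_point; unfold zero; simpl; ring).
    rewrite Rminus_0_r, Cmult_1_l; unfold expi; f_equal; field.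
  - intros k hk; unfold Rcorr_term; rewrite opp_IZR, !RtoC_opp.
    replace (sign (2 * - IZR k + 3 / 2)) with (- sign (2 * IZR k + 3 / 2)).
    + replace ((2 * - IZR k + 0) * sqrt (Im tau)) with (- ((2 * IZR k + 0) * sqrt (Im tau)))
        by ring.
      rewrite E_opp; apply RtoC_mult_opp; [ring | f_equal; ring].
    + destruct (Z.lt_gt_cases k 0) as [h _]; destruct (h hk) as [h1 | h1].
      * assert (IZR k <= -1) by (apply IZR_le; lia).
        rewrite sign_eq_m1, sign_eq_1; lra.
      * assert (1 <= IZR k) by (apply IZR_le; lia).
        rewrite sign_eq_1, sign_eq_m1; lra.
Qed.

(** For integer l the numbers 2l + 3/2 and 2l + 1 have the same sign, and l -> -l - 1 negates 2l +
    1; hence the bracket is odd with no exceptional term. *)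
Lemma Rcorr_1 (D : Z) (tau : C) : 0 < Im tau ->
  Rcorr (1 / 2 + 1) 2 tau (tau / 4 - IZR D / 2) = 0%C.
Proof.
  intros htau; rewrite Rcorr_eq by exact htau.
  apply sumZ_half_odd; intros k; unfold Rcorr_term; rewrite minus_IZR, opp_IZR.
  replace (sign (2 * (- IZR k - 1) + 3 / 2)) with (- sign (2 * IZR k + 3 / 2)).
  - replace ((2 * (- IZR k - 1) + 1) * sqrt (Im tau)) with
      (- ((2 * IZR k + 1) * sqrt (Im tau))) by ring.
    rewrite E_opp; apply RtoC_mult_opp; [ring |].
    rewrite RtoC_minus, RtoC_opp; f_equal; ring.
  - destruct (Z.le_gt_cases 0 k) as [h | h].
    + apply IZR_le in h; rewrite sign_eq_1, sign_eq_m1; lra.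
    + assert (IZR k <= -1) by (apply IZR_le; lia).
      rewrite sign_eq_m1, sign_eq_1; lra.
Qed.

(** Of the indices k = 1/2, 3/2 only the first contributes, and its value e^{2 PI i (tau/16 - D/4)}
    is exactly the prefactor of [Phi_shift] at m = 1, s = 1/2. So [Phi_add] is half the difference
    of the two [Phi]. *)
Lemma Phi_mod_eq (D : Z) (tau z1 z2 t : C) : 0 < Im tau -> Phi_nonpole tau z1 z2 ->
  ((z1 - z2) / 2)%C = (tau / 4 - IZR D / 2)%C ->
  Phi_mod 2 1 tau z1 z2 t = (1 / 2 * (Phi 2 1 tau z1 z2 t + Phi 2 3 tau z1 z2 t))%C.
Proof.
  intros htau hp hw.
  assert (h := Phi_shift 2 1 tau z1 z2 t (Nat.lt_0_succ 1) htau hp).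
  change (1 + 2)%Z with 3%Z in h; cbv zeta in h.
  replace (Phi 2 3 tau z1 z2 t) with
    (Phi 2 1 tau z1 z2 t + (Phi 2 3 tau z1 z2 t - Phi 2 1 tau z1 z2 t))%C by ring.
  rewrite h; unfold Phi_mod, Phi_add, Csum; simpl List.fold_right; cbv zeta.
  replace (half_int 1 + 0) with (1 / 2) by (unfold half_int; ring).
  unfold half_int at 2; rewrite hw, Rcorr_0, Rcorr_1 by exact htau.
  replace (expi (theta_exponent (half_nat 2) (half_int 1) tau z1 z2))
    with (expi (tau / 16 - IZR D / 4)).
  - unfold half_int; field.
  - f_equal; unfold theta_exponent; rewrite hw.
    unfold half_nat, half_int; simpl INR.
    replace ((1 + 1) / 2) with 1 by field; rewrite RtoC_div by lra; field.
Qed.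

(** * Characters *)

Lemma numerator_mod_eq (e : pm) (tau z : C) : 0 < Im tau ->
  Phi_nonpole (2 * tau) (z + Defs.shift e tau) (z - Defs.shift e tau) ->
  numerator Phi_mod e 0 tau z =
  (1 / 2 * (numerator Phi e 0 tau z + numerator Phi e 2 tau z))%C.
Proof.
  intros htau hp; unfold numerator.
  (* Here (z1 - z2)/2 is [shift e tau], that is (2 tau)/4 - D/2 for the modular parameter 2 tau; D
     records the -1/2 of the [Plus] case. *)
  apply (Phi_mod_eq (match e with Plus => 1 | Minus => 0 end)%Z); [| exact hp |].
  - destruct tau; simpl in *; lra.
  - destruct e; simpl; field.
Qed.

(* The poles lie on the lines Im z = (2j +- 1/2) Im tau. *)
Lemma nonpole_dense (e : pm) (tau z : C) (P : C -> Prop) : 0 < Im tau ->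
  locally' z P ->
  exists z', P z' /\
    Phi_nonpole (2 * tau) (z' + Defs.shift e tau) (z' - Defs.shift e tau).
Proof.
  intros htau [eps hP].
  set (y := Im tau) in *.
  set (a := 2 * Im z / y).
  destruct (archimed a) as [ha _].
  (* Moving z upwards by [d] stays in the ball and puts 2 (Im z + d) strictly between a y and (up a)
     y. As up a - 1 <= a, no integer multiple of y lies there, whereas at a pole 2 Im z is such a
     multiple. *)
  set (d := Rmin (eps / 2) ((IZR (up a) - a) * y / 4)).
  assert (heps := cond_pos eps).
  assert (hd0 : 0 < d).
  { apply Rmin_glb_lt; [lra |]; apply Rdiv_lt_0_compat; [apply Rmult_lt_0_compat |]; lra. }
  assert (hd1 : d <= eps / 2) by apply Rmin_l.
  assert (hd2 : d <= (IZR (up a) - a) * y / 4) by apply Rmin_r.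
  assert (haz : 2 * Im z = a * y) by (unfold a; field; lra).
  destruct (archimed a) as [_ ha'].
  assert (hno : forall n : Z, 2 * (Im z + d) <> IZR n * y).
  { intros n hn; rewrite Rmult_plus_distr_l, haz in hn.
    destruct (Z.lt_ge_cases n (up a)) as [h | h].
    - assert (IZR n + 1 <= IZR (up a)) by (rewrite <- plus_IZR; apply IZR_le; lia). nra.
    - apply IZR_le in h. nra. }
  assert (hsh : Im (Defs.shift e tau) = y / 2).
  { destruct e, tau; unfold y; simpl; field. }
  exists (z + (0, d))%C; split.
  - apply hP.
    + split; simpl; unfold ball; simpl; unfold AbsRing_ball, abs, minus, plus, opp; simpl.
      * replace (fst z + 0 + - fst z) with 0 by ring; rewrite Rabs_R0; lra.
      * replace (snd z + d + - snd z) with d by ring; rewrite Rabs_pos_eq; lra.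
    + intros h; apply (f_equal Im) in h; change (Im z + d = Im z) in h; lra.
  - assert (hne : forall (w : C) (j : Z), Im w + 2 * IZR j * y <> 0 ->
      (1 - expi w * expi (IZR j * (2 * tau)))%C <> 0%C).
    { intros w j hw h; apply hw.
      assert (h1 : (expi w * expi (IZR j * (2 * tau)))%C = 1%C).
      { transitivity (1 - (1 - expi w * expi (IZR j * (2 * tau))))%C; [ring |].
        rewrite h; ring. }
      apply (f_equal Cmod) in h1; rewrite Cmod_expi_mult, Cmod_1, <- exp_0 in h1.
      apply exp_inv in h1.
      replace (Im (2 * tau)) with (2 * y) in h1 by (unfold y; destruct tau; simpl; ring).
      assert (hpi := PI_RGT_0).
      assert (h2 : PI * (Im w + 2 * IZR j * y) = 0) by lra.
      apply Rmult_integral in h2 as [h2 | h2]; [lra | exact h2]. }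
    intros j; split; apply hne; intros h.
    + apply (hno (- (4 * j) - 1)%Z).
      rewrite minus_IZR, opp_IZR, mult_IZR.
      rewrite im_plus, im_plus, hsh in h; simpl in h; lra.
    + apply (hno (4 * j + 1)%Z).
      rewrite plus_IZR, mult_IZR.
      change (- (Im z + d + - Im (Defs.shift e tau)) + 2 * IZR j * y = 0) in h.
      rewrite hsh in h; lra.
Qed.

(** Passes from the neighbourhoods of the product uniform structure on [C] to discs for [Cmod], in
    which the triangle inequality is applied. *)
Lemma locally'_ball (z a : C) (f : C -> C) (eps : posreal) :
  filterlim f (locally' z) (locally a) ->
  locally' z (fun z' => Cmod (f z' - a) < eps).
Proof.
  intros h; apply (h (fun w => Cmod (w - a) < eps)).
  apply (locally_le_locally_norm (K := C_AbsRing) (V := C_NormedModule)).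
  exists eps; intros w hw; exact hw.
Qed.

Theorem corollary6p1 :
  forall (e : pm) (ch0 ch2 chmod0 : C -> C -> C),
    is_character e 0 ch0 ->
    is_character e 2 ch2 ->
    is_modified_character e 0 chmod0 ->
    forall tau z : C, (0 < Im tau)%R ->
      (chmod0 tau z = 1 / 2 * (ch0 tau z + ch2 tau z))%C.
Proof.
  intros e ch0 ch2 chmod0 h0 h2 hm tau z htau.
  destruct (h0 tau z htau) as [r0 s0], (h2 tau z htau) as [r2 s2],
    (hm tau z htau) as [rm sm].
  destruct (classic (regular_point e tau z)) as [hr | hr].
  - specialize (r0 hr); specialize (r2 hr); specialize (rm hr).
    destruct hr as (hp & _ & hR).
    rewrite numerator_mod_eq, <- r0, <- r2 in rm by assumption.
    transitivity (/ Rden e tau z * (Rden e tau z * chmod0 tau z))%C; [field; auto |].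
    rewrite rm; field; auto.
  - specialize (s0 hr); specialize (s2 hr); specialize (sm hr).
    set (x := (chmod0 tau z - 1 / 2 * (ch0 tau z + ch2 tau z))%C).
    destruct (classic (x = 0%C)) as [hx | hx].
    { apply Ceq_minus; exact hx. }
    exfalso; apply Cmod_gt_0 in hx.
    (* With three errors below |x|/4, the final estimate reads |x| < (1/2)(|x|/4 + |x|/4) + |x|/4 =
       |x|/2, a contradiction. *)
    assert (hx4 : 0 < Cmod x / 4) by lra.
    set (eps := mkposreal _ hx4).
    destruct (nonpole_dense e tau z _ htau
      (filter_and _ _ (locally'_ball _ _ _ eps s0)
        (filter_and _ _ (locally'_ball _ _ _ eps s2) (locally'_ball _ _ _ eps sm))))
      as (w & (w0 & w2 & wm) & hp).
    rewrite numerator_mod_eq in wm by assumption.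
    set (f0 := (numerator Phi e 0 tau w / Rden e tau w)%C) in *.
    set (f2 := (numerator Phi e 2 tau w / Rden e tau w)%C) in *.
    simpl in w0, w2, wm.
    (* The factor [/ Rden e tau w] is common to the three quotients, so the linear relation of the
       numerators at the nonpole [w] passes to them. *)
    match type of wm with Cmod (?f - _) < _ =>
      replace f with (1 / 2 * (f0 + f2))%C in wm by (unfold f0, f2, Cdiv; ring) end.
    assert (hxe : x = (1 / 2 * ((f0 - ch0 tau z) + (f2 - ch2 tau z))
      - (1 / 2 * (f0 + f2) - chmod0 tau z))%C) by (unfold x; ring).
    assert (hb : Cmod x <= 1 / 2 * (Cmod (f0 - ch0 tau z) + Cmod (f2 - ch2 tau z))
      + Cmod (1 / 2 * (f0 + f2) - chmod0 tau z)).
    { rewrite hxe at 1; unfold Cminus at 1.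
      eapply Rle_trans; [apply Cmod_triangle |]; rewrite Cmod_opp.
      apply Rplus_le_compat_r; rewrite Cmod_mult.
      replace (Cmod (1 / 2)) with (1 / 2)
        by (rewrite <- RtoC_div, Cmod_R, Rabs_pos_eq; lra).
      apply Rmult_le_compat_l; [lra | apply Cmod_triangle]. }
    lra.
Qed.
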